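(* In Tchoukaillon with an unlimited number of pits, for every integer $s \geq 0$ there is exactly one winning position involving a total of $s$ stones.
   Context: **Tchoukaillon.** This is a solitaire game on a row of pits numbered $1, 2, 3, \ldots$ (here an unlimited number of pits, only finitely many of which are non-empty), each containing some number of stones, together with an additional pit, the Roumba, which may be regarded as pit $0$. A move consists of harvesting a pit $i$. Pit $i$ may be harvested if and only if it contains exactly $i$ stones ($i \ge 1$). Its $i$ stones are removed and one stone is placed in each of the pits $i-1, i-2, \ldots, 1$ and one in the Roumba. The game is won if all stones have been put in the Roumba. A winning (or winnable) position is a position from which a win is possible. The position with no stones in the pits is winning. The total number of stones of a position counts the stones in the pits $1, 2, 3, \ldots$ (not the Roumba). *)

(* Defs.v *)
From mathcomp Require Import all_boot.
From mathcomp Require Import finmap.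
From Stdlib Require Export Relation_Operators.

Set Implicit Arguments.
Unset Strict Implicit.
Unset Printing Implicit Defensive.

(* The pits 1, 2, 3, ...; the Roumba is not a pit and is kept separately. *)
Definition pit : Type := {i : nat | 0 < i}.

(* All but finitely many pits are empty. *)
Definition position : Type := {fsfun pit -> nat with 0}.

Definition stones (p : position) : nat := (\sum_(k <- finsupp p) p k)%N.

Record state : Type := State { roumba : nat; pits : position }.

(* The pointwise equations determine [t] from [s] and [i]. *)
Definition harvest (i : pit) (s t : state) : Prop :=
  [/\ pits s i = val i,
      roumba t = (roumba s).+1
    & forall k : pit,
        pits t k = if val k < val i then (pits s k).+1
                   else if k == i then 0
                   else pits s k].

Definition move (s t : state) : Prop := exists i : pit, harvest i s t.

Definition won (s : state) : Prop := forall k : pit, pits s k = 0.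

(* The content of the Roumba affects neither the legality of a move nor [won],
   so starting with an empty Roumba is only a normalization. *)
Definition winning (p : position) : Prop :=
  exists2 t : state, clos_refl_trans state move (State 0 p) t & won t.

(* Main.v *)
Require Import Defs.
From mathcomp Require Import all_boot.
From mathcomp Require Import finmap.
From Stdlib Require Import Operators_Properties.

(** The game is deterministic when it is played backwards.  Harvesting pit [i]
    leaves [i] empty and every lower pit non-empty, so in the resulting position
    [i] is the lowest empty pit.  Hence [i], and with it the position before the
    move, can be read off from the position after the move
    ([harvest_inj]).  Conversely, a position has only finitely many non-empty
    pits, so it has a lowest empty pit, and the harvest of that pit can always be
    undone ([unharvest]).

    A harvest puts exactly one stone in the Roumba, so it lowers the number of
    stones in the pits by one ([harvest_stones]), and every win from [s] stones
    takes exactly [s] moves.  By induction on [s], the only winning position with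
    [s] stones is the one obtained from the empty position by undoing [s] moves:
    existence is [winnable_exists] and uniqueness is [winnable_uniq]. *)

Set Implicit Arguments.
Unset Strict Implicit.
Unset Printing Implicit Defensive.

Local Open Scope fset_scope.

(** * Counting stones *)

Definition nth_pit (n : nat) : pit := exist _ n.+1 (ltn0Sn n).

Lemma nth_pitP (k : pit) : k = nth_pit (val k).-1.
Proof. by apply: val_inj; case: k => -[]. Qed.

Lemma nth_pit_inj : injective nth_pit.
Proof. by move=> m n /(congr1 val) []. Qed.

(** Turning the sum over the support into a sum over an initial segment allows
    two positions with different supports to be compared term by term. *)
Lemma stones_bounded (p : position) N :
    (forall k, k \in finsupp p -> val k <= N) ->
  stones p = \sum_(n < N) p (nth_pit n).
Proof.
move=> leN; rewrite -(big_mkord xpredT (fun n => p (nth_pit n))).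
rewrite -(big_map nth_pit xpredT p) [RHS](bigID (mem (finsupp p))) /=.
rewrite [X in (_ + X)%N]big1 => [|k /fsfun_dflt //]; rewrite addn0 -big_filter.
apply: perm_big; apply: uniq_perm; first exact: fset_uniq.
  by rewrite filter_uniq // (map_inj_uniq nth_pit_inj) iota_uniq.
move=> k; rewrite mem_filter; apply/idP/andP => [kp | [] //]; split=> //.
rewrite (nth_pitP k) (mem_map nth_pit_inj) mem_index_iota /=.
by have := leN k kp; case: (k) => -[].
Qed.

Lemma finsupp_bounded (p : position) :
  exists N, forall k, k \in finsupp p -> val k <= N.
Proof.
exists (\sum_(k <- finsupp p) val k)%N => k kp.
by rewrite (big_fsetD1 k kp) /= leq_addr.
Qed.

(** The harvested pit loses [i] stones and only [i - 1] of them land in pits. *)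
Lemma harvest_stones i s t :
  harvest i s t -> stones (pits s) = (stones (pits t)).+1.
Proof.
case=> si _ tE.
have [N1 le1] := finsupp_bounded (pits s).
have [N2 le2] := finsupp_bounded (pits t).
pose N := maxn (val i) (maxn N1 N2).
rewrite (@stones_bounded _ N) => [|k /le1 kN]; last by rewrite !leq_max kN !orbT.
rewrite (@stones_bounded _ N) => [|k /le2 kN]; last by rewrite !leq_max kN !orbT.
have: val i <= N by exact: leq_maxl.
move: N si tE; rewrite (nth_pitP i); move: (val i).-1 => j {le1 le2} N si tE ltjN.
(* The sown stones are added on the side of [s] and the harvested ones on the
   side of [t], so that the term-by-term comparison needs no subtraction. *)
have E n : (pits s (nth_pit n) + (n < j) =
            pits t (nth_pit n) + (if n == j then j.+1 else 0))%N.
  rewrite tE /= (inj_eq nth_pit_inj) ltnS.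
  by case: ltngtP => [||->]; rewrite ?addn1 ?addn0 // si.
apply: (@addIn j); rewrite addSnnS.
have <- : (\sum_(n < N) (if n == j :> nat then j.+1 else 0) = j.+1)%N.
  by rewrite -big_mkcond (big_pred1 (Ordinal ltjN)).
have {1}<- : (\sum_(n < N) (n < j) = j)%N.
  rewrite -[RHS]card_ord -sum1_card (big_ord_widen N (fun=> 1%N) (ltnW ltjN)).
  by rewrite [RHS]big_mkcond; apply: eq_bigr => n _; case: (n < j).
by rewrite -!big_split; apply: eq_bigr => n _; exact: E.
Qed.

Lemma won_stones s : won s -> stones (pits s) = 0.
Proof. by move=> s0; apply: big1 => k _; exact: s0. Qed.

(** * Playing backwards *)

(** The harvested pit is the lowest empty one afterwards, so each of the two
    pits bounds the other. *)
Lemma harvest_pit_leq i i' s t s' t' :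
  harvest i s t -> harvest i' s' t' -> pits t = pits t' -> val i <= val i'.
Proof.
move=> [_ _ tE] [_ _ t'E] eq_t; rewrite leqNgt; apply/negP => lt_i'i.
by have := tE i'; rewrite eq_t t'E ltnn eqxx lt_i'i.
Qed.

Lemma harvest_inj i i' s t s' t' :
  harvest i s t -> harvest i' s' t' -> pits t = pits t' -> pits s = pits s'.
Proof.
move=> hs hs' eq_t.
have eq_i : i = i'.
  apply/val_inj/anti_leq; rewrite (harvest_pit_leq hs hs' eq_t).
  by rewrite (harvest_pit_leq hs' hs (esym eq_t)).
case: hs hs' => si _ tE; rewrite -eq_i => -[s'i _ t'E].
apply/fsfunP => k; have := tE k; rewrite eq_t t'E.
by case: ifP => _; [case | case: eqP => [-> _|//]; rewrite si s'i].
Qed.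

Lemma unharvest (q : position) :
  exists i p, forall r, harvest i (State r p) (State r.+1 q).
Proof.
have ex0 : exists n, q (nth_pit n) == 0.
  have [N leN] := finsupp_bounded q; exists N; apply/eqP/fsfun_dflt.
  by apply/negP => /leN; rewrite /= ltnn.
case: (ex_minnP ex0) => j /eqP qj0 jmin.
pose i := nth_pit j.
have q_gt0 (k : pit) : val k < val i -> 0 < q k.
  rewrite (nth_pitP k) ltnS lt0n => ltkj; apply/negP => /jmin.
  by rewrite leqNgt ltkj.
pose before (k : pit) := if val k < val i then (q k).-1 else if k == i then val i else q k.
pose p : position := [fsfun k in i |` finsupp q => before k].
have pE (k : pit) : p k = before k.
  rewrite fsfunE in_fset1U; case: ifP => // /norP[/negPf ki kq].
  have qk0 := fsfun_dflt kq.
  by rewrite /before ki qk0; case: ifP.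
exists i, p => r; split=> //= [|k]; rewrite pE /before.
  by rewrite ltnn eqxx.
case: ifP => [ltki | nltki]; first by rewrite ifT // prednK ?q_gt0.
by case: ifP => [/eqP-> // | nki]; rewrite ifF // ifF.
Qed.

(** * Winning positions *)

(** A move changes the content of the Roumba, so winning has to be considered
    from arbitrary states for induction on the number of stones to apply. *)
Definition winnable (s : state) : Prop :=
  exists2 t : state, clos_refl_trans state move s t & won t.

Lemma winnableP s :
  winnable s -> won s \/ exists i s', harvest i s s' /\ winnable s'.
Proof.
case=> t st wt; case: (clos_rt_rt1n _ _ _ _ st) wt => [|s' t' [i hi] s't'] wt.
  by left.
by right; exists i, s'; split=> //; exists t' => //; exact: clos_rt1n_rt.
Qed.

Lemma winnable_uniq n s s' :
    winnable s -> winnable s' -> stones (pits s) = n -> stones (pits s') = n ->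
  pits s = pits s'.
Proof.
elim: n s s' => [|n IHn] s s' /winnableP ws /winnableP ws' sn s'n.
  case: ws => [ws|[i [t [/harvest_stones]]]]; last by rewrite sn.
  case: ws' => [ws'|[i [t [/harvest_stones]]]]; last by rewrite s'n.
  by apply/fsfunP => k; rewrite ws ws'.
case: ws => [/won_stones|[i [t [hs wt]]]]; first by rewrite sn.
case: ws' => [/won_stones|[i' [t' [hs' wt']]]]; first by rewrite s'n.
apply: (harvest_inj hs hs'); apply: IHn => //; apply: succn_inj.
  by rewrite -(harvest_stones hs).
by rewrite -(harvest_stones hs').
Qed.

Lemma winnable_exists n :
  exists p, (forall r, winnable (State r p)) /\ stones p = n.
Proof.
elim: n => [|n [q [wq <-]]].
  exists [fsfun] => /=.
  have w0 r : won (State r [fsfun]) by move=> k; rewrite /= fsfun0E.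
  split=> [r|]; last exact: won_stones (w0 0).
  by exists (State r [fsfun]); [exact: rt_refl | exact: w0].
have [i [p hp]] := unharvest q; exists p; split=> [r|].
  have [t qt wt] := wq r.+1; exists t => //.
  by apply: rt_trans qt; apply: rt_step; exists i.
exact: harvest_stones (hp 0).
Qed.

Theorem theorem5 (s : nat) :
  exists! p : position, winning p /\ stones p = s.
Proof.
have [p [wp ps]] := winnable_exists s.
exists p; split=> [|q [wq qs]]; first by split=> //; exact: wp.
exact: winnable_uniq (wp 0) wq ps qs.
Qed.
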